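(* Let $k$ be a field, $G$ an abelian group, $\epsilon$ a skew-symmetric bicharacter of $G$ over $k$, and $A$ a finite-dimensional left-symmetric color algebra with respect to $(G,\epsilon)$. Let $V$ and $W$ be two finite-dimensional $A$-bimodules and suppose that $V$ is complete. Then the $G$-graded vector space $V\otimes W$ is an $A$-bimodule with the left and right actions $$x(v\otimes w):=\big(xv-\epsilon(|x|,|v|)vx\big)\otimes w+\epsilon(|x|,|v|)\,v\otimes(xw),$$ $$(v\otimes w)x:=v\otimes(wx)$$ for all homogeneous $x\in A$, $v\in V$, $w\in W$.
   Context: Conventions. $k$ is a field of any characteristic; all algebras and modules are finite-dimensional. A skew-symmetric bicharacter of an abelian group $G$ over $k$ is a map $\epsilon:G\times G\to k^\times$ with $\epsilon(a,b+c)=\epsilon(a,b)\epsilon(a,c)$, $\epsilon(a+b,c)=\epsilon(a,c)\epsilon(b,c)$ and $\epsilon(a,b)\epsilon(b,a)=1$. $|x|\in G$ denotes the degree of a homogeneous element $x$. Formulas given on homogeneous elements are extended linearly. Left-symmetric color algebra: a (nonassociative) $G$-graded $k$-algebra $A=\bigoplus_{a\in G}A_a$, $A_aA_b\subseteq A_{a+b}$, with $(xy)z-x(yz)=\epsilon(|x|,|y|)\big((yx)z-y(xz)\big)$ for homogeneous $x,y,z$. The associated Lie color algebra $[A]$ is the graded space $A$ with bracket $[x,y]=xy-\epsilon(|x|,|y|)yx$ for homogeneous $x,y$. $A$-bimodule: a $G$-graded vector space $W$ with bilinear degree-compatible left and right actions of $A$ (i.e. $A_aW_b\subseteq W_{a+b}$,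 $W_bA_a\subseteq W_{a+b}$) such that for homogeneous $x,y\in A$, $w\in W$: $(xy)w-x(yw)=\epsilon(|x|,|y|)\big((yx)w-y(xw)\big)$ and $(xw)y-x(wy)=\epsilon(|x|,|w|)\big((wx)y-w(xy)\big)$. An $A$-bimodule $V$ is complete if its right action makes it a right $[A]$-module, i.e. $v[x,y]=(vx)y-\epsilon(|x|,|y|)(vy)x$ for all homogeneous $x,y\in A$ and $v\in V$. The tensor product is graded by $(V\otimes W)_a=\bigoplus_{b\in G}V_b\otimes W_{a-b}$. *)

(* Defs.v *)
From HB Require Import structures.
From mathcomp Require Import all_boot all_order all_algebra.

Set Implicit Arguments.
Unset Strict Implicit.
Unset Printing Implicit Defensive.

Import GRing.Theory.
Local Open Scope ring_scope.

Record skew_bicharacter (k : fieldType) (G : zmodType) := SkewBicharacter {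
  bichar :> G -> G -> k;
  bichar_neq0 : forall a b, bichar a b != 0;
  bicharDr : forall a b c, bichar a (b + c) = bichar a b * bichar a c;
  bicharDl : forall a b c, bichar (a + b) c = bichar a c * bichar b c;
  bichar_skew : forall a b, bichar a b * bichar b a = 1
}.

(* The index group may be infinite, so the direct sum decomposition is stated
   over finite sequences of degrees: the components of some finite sequence
   span, and any finitely many distinct components are in direct sum. *)
Record gradedVect (k : fieldType) (G : zmodType) := GradedVect {
  gr_sort :> vectType k;
  hcomp : G -> {vspace gr_sort};
  hcomp_full : exists s : seq G, (\sum_(a <- s) hcomp a == fullv)%VS;
  hcomp_direct : forall s : seq G, uniq s -> directv (\sum_(a <- s) hcomp a)
}.

Lemma directv_sum_cons (k : fieldType) (V : vectType k) (I : Type)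
    (U : I -> {vspace V}) (i : I) (s : seq I) :
  directv (\sum_(j <- i :: s) U j) =
  directv (\sum_(j <- s) U j) && (U i :&: \sum_(j <- s) U j == 0)%VS.
Proof.
have := directv_addE (trivial_addv (U i))
          (proper_addv (nary_addv_expr s xpredT (fun j => trivial_addv (U j)))).
by rewrite /= directv_trivial /= !directvE /= !big_cons.
Qed.

Lemma directv_sum_proj (k : fieldType) (V : vectType k) (I : eqType)
    (U : I -> {vspace V}) (p : I -> 'End(V)) :
  (forall i j v, v \in U i -> p j v = if j == i then v else 0) ->
  forall s : seq I, uniq s -> directv (\sum_(i <- s) U i).
Proof.
move=> pE; elim=> [|i s IHs]; first by rewrite directvE /= !big_nil dimv0.
case/andP=> is_ Us; rewrite directv_sum_cons IHs //= -subv0.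
apply/subvP => v /memv_capP[vi vs]; rewrite memv0.
have {1}<- : p i v = v by rewrite (pE _ _ _ vi) eqxx.
rewrite -memv_ker; apply: (subvP _ _ vs); rewrite big_seq.
elim/big_ind: _ => [|X Y XT YT|j js]; rewrite ?sub0v ?subv_add ?XT //.
apply/subvP => u uj; rewrite memv_ker (pE _ _ _ uj).
by have [ij|_] := eqVneq i j; [rewrite ij js in is_ | rewrite eqxx].
Qed.

Section GradedTheory.
Variables (k : fieldType) (G : zmodType) (V : gradedVect k G).

Lemma hcomp_indep (s : seq G) (f : G -> V) :
  uniq s -> (forall a, f a \in hcomp V a) -> \sum_(a <- s) f a = 0 ->
  forall a, a \in s -> f a = 0.
Proof.
move=> + Vf; elim: s => [//|b s IHs] Us.
have := hcomp_direct V Us; rewrite directv_sum_cons => /andP[_ /eqP dx].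
move: Us => /= /andP[_ Us]; rewrite big_cons => fs0.
have fsV : \sum_(a <- s) f a \in (\sum_(a <- s) hcomp V a)%VS.
  elim: (s) => [|c r IHr]; first by rewrite !big_nil mem0v.
  by rewrite !big_cons memv_add.
have fb0 : f b = 0.
  apply/eqP; rewrite -memv0 -dx memv_cap Vf /=.
  by rewrite -memvN; move/eqP: fs0; rewrite addrC addr_eq0 => /eqP <-.
move=> a; rewrite inE => /predU1P[->//|]; apply: IHs => //.
by rewrite fb0 add0r in fs0.
Qed.

(* A finite set of degrees outside which the components vanish. *)
Definition hsupp : seq G := undup (xchoose (hcomp_full V)).

Lemma hsupp_uniq : uniq hsupp. Proof. exact: undup_uniq. Qed.

Lemma hsupp_full : (\sum_(a <- hsupp) hcomp V a)%VS = fullv.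
Proof.
apply/eqP; rewrite eqEsubv subvf /= -(eqP (xchooseP (hcomp_full V))) /hsupp.
elim: (xchoose _) => [|a s IHs] /=; first by rewrite big_nil sub0v.
rewrite big_cons subv_add; case: ifP => as_.
  rewrite IHs andbT (big_rem a) /=; last by rewrite mem_undup.
  exact: addvSl.
by rewrite big_cons addvSl (subv_trans IHs (addvSr _ _)).
Qed.

Lemma hcomp_notin_hsupp (a : G) (v : V) :
  v \in hcomp V a -> a \notin hsupp -> v = 0.
Proof.
move=> Vv aS; pose d b := sumv_pi_for (esym hsupp_full) b v.
have vE : \sum_(b <- hsupp) d b = v.
  by apply: sumv_pi_uniq_sum; rewrite ?memvf // filter_predT hsupp_uniq.
have -> : v = - (if a == a then - v else d a) by rewrite eqxx opprK.
apply/eqP; rewrite oppr_eq0; apply/eqP.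
apply: (@hcomp_indep (a :: hsupp) (fun b => if b == a then - v else d b));
  rewrite /= ?aS ?hsupp_uniq ?inE ?eqxx //.
  by move=> b; case: eqP => [->|_]; rewrite ?memvN // memv_sum_pi.
rewrite big_cons eqxx (eq_big_seq d) ?vE ?addNr // => b bS.
by case: eqP => // ba; rewrite -ba bS in aS.
Qed.

Definition hproj (a : G) : 'End(V) := sumv_pi_for (esym hsupp_full) a.

Lemma hproj_sum (v : V) : \sum_(a <- hsupp) hproj a v = v.
Proof. by apply: sumv_pi_uniq_sum; rewrite ?memvf // filter_predT hsupp_uniq. Qed.

Lemma hproj_mem (a : G) (v : V) : hproj a v \in hcomp V a.
Proof. exact: memv_sum_pi. Qed.

Lemma hprojE (a b : G) (v : V) :
  v \in hcomp V a -> hproj b v = if b == a then v else 0.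
Proof.
move=> Vv; have [bS|bS] := boolP (b \in hsupp); last first.
  rewrite (hcomp_notin_hsupp (hproj_mem b v) bS); case: eqP => // ba.
  by rewrite (hcomp_notin_hsupp Vv) // -ba.
apply: subr0_eq.
pose f c : V := hproj c v - (if c == a then v else 0).
apply: (hcomp_indep (f := f) hsupp_uniq _ _ bS).
  by move=> c; rewrite memvB ?hproj_mem //; case: eqP => [->|_]; rewrite ?mem0v.
rewrite sumrB hproj_sum -big_mkcond /=.
have [aS|aS] := boolP (a \in hsupp).
  rewrite -big_filter (perm_big [:: a]) ?big_seq1 ?subrr //.
  apply: uniq_perm; rewrite ?filter_uniq ?hsupp_uniq //.
  by move=> c; rewrite mem_filter inE andb_idr // => /eqP ->.
by rewrite (hcomp_notin_hsupp Vv aS) big1 ?subrr.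
Qed.

End GradedTheory.

(* Tensor product of finite-dimensional spaces, modelled by the matrices of
   coordinates; tens_liftE and tens_ext are its universal property. *)
Section Tensor.
Variables (k : fieldType) (V W : vectType k).

Definition tens : vectType k := 'M[k]_(\dim {:V}, \dim {:W}).

Definition tmul (v : V) (w : W) : tens :=
  \matrix_(i, j) (coord (vbasis {:V}) i v * coord (vbasis {:W}) j w).

Fact tmul_is_bilinear : bilinear_for *:%R *:%R tmul.
Proof.
split=> [w|v] c x y /=; apply/matrixP => i j; rewrite !mxE linearP /=.
  by rewrite mulrDl mulrA.
by rewrite mulrDr mulrCA.
Qed.
HB.instance Definition _ :=
  bilinear_isBilinear.Build k V W tens *:%R *:%R tmul tmul_is_bilinear.

Definition tens_lift (U : lmodType k) (f : V -> W -> U) (t : tens) : U :=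
  \sum_i \sum_j t i j *: f (vbasis {:V})`_i (vbasis {:W})`_j.

Fact tens_lift_is_linear (U : lmodType k) (f : V -> W -> U) :
  linear (tens_lift f).
Proof.
move=> c s t; rewrite /tens_lift scaler_sumr -big_split; apply: eq_bigr => i _.
rewrite scaler_sumr -big_split; apply: eq_bigr => j _.
by rewrite !mxE scalerDl scalerA.
Qed.
HB.instance Definition _ (U : lmodType k) (f : V -> W -> U) :=
  GRing.isLinear.Build k tens U *:%R (tens_lift f) (tens_lift_is_linear f).

Lemma tens_liftE (U : lmodType k) (f : {bilinear V -> W -> U}) v w :
  tens_lift f (tmul v w) = f v w.
Proof.
rewrite [in RHS](coord_vbasis (memvf v)) [in RHS](coord_vbasis (memvf w)).
rewrite linear_sumlz; apply: eq_bigr => i _.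
rewrite linear_sumr; apply: eq_bigr => j _.
by rewrite linearZr_LR /= linearZl_LR /= scalerA !mxE mulrC.
Qed.

Lemma tens_sum (t : tens) :
  t = \sum_i \sum_j t i j *: tmul (vbasis {:V})`_i (vbasis {:W})`_j.
Proof.
rewrite [LHS]matrix_sum_delta; apply: eq_bigr => i _; apply: eq_bigr => j _.
congr (_ *: _); apply/matrixP => i' j'; rewrite !mxE.
by rewrite !coord_free ?(basis_free (vbasisP _)) // -natrM mulnb ![_ == i]eq_sym ![_ == j]eq_sym.
Qed.

Lemma tens_ext (U : lmodType k) (f g : {linear tens -> U}) :
  (forall v w, f (tmul v w) = g (tmul v w)) -> f =1 g.
Proof.
move=> fg t; rewrite [t]tens_sum !linear_sum; apply: eq_bigr => i _.
by rewrite !linear_sum; apply: eq_bigr => j _; rewrite !linearZ /= fg.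
Qed.

Definition tensv (X : {vspace V}) (Y : {vspace W}) : {vspace tens} :=
  <<[seq tmul v w | v <- vbasis X, w <- vbasis Y]>>%VS.

Lemma memv_tens (X : {vspace V}) (Y : {vspace W}) v w : v \in X -> w \in Y -> tmul v w \in tensv X Y.
Proof.
move=> /coord_vbasis -> /coord_vbasis ->.
rewrite linear_sumlz memv_suml // => i _; rewrite linear_sumr memv_suml // => j _.
rewrite linearZr_LR /= memvZ // linearZl_LR /= memvZ //.
by apply: memv_span; apply: allpairs_f; apply: mem_nth; rewrite size_tuple.
Qed.

Lemma tensv_subv (X : {vspace V}) (Y : {vspace W}) (T : {vspace tens}) :
  (forall v w, v \in X -> w \in Y -> tmul v w \in T) -> (tensv X Y <= T)%VS.
Proof.
move=> XYT; apply/span_subvP => _ /allpairsP[[v w] /= [vX wY ->]].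
by rewrite XYT ?vbasis_mem.
Qed.

End Tensor.

Section GradedTensor.
Variables (k : fieldType) (G : zmodType) (V W : gradedVect k G).

(* The sum over all b in G of V_b (x) W_(a - b); the terms with b outside
   hsupp V vanish. *)
Definition gtens_comp (a : G) : {vspace tens V W} :=
  (\sum_(b <- hsupp V) tensv (hcomp V b) (hcomp W (a - b)))%VS.

Lemma memv_gtens a b v w :
  v \in hcomp V b -> w \in hcomp W (a - b) -> tmul v w \in gtens_comp a.
Proof.
move=> Vv Ww; have [bS|bS] := boolP (b \in hsupp V); last first.
  by rewrite (hcomp_notin_hsupp Vv bS) linear0l mem0v.
rewrite /gtens_comp (big_rem b) //=; apply: (subvP (addvSl _ _)).
exact: memv_tens.
Qed.

Lemma gtens_comp_subv a (T : {vspace tens V W}) :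
  (forall b v w, v \in hcomp V b -> w \in hcomp W (a - b) -> tmul v w \in T) ->
  (gtens_comp a <= T)%VS.
Proof.
move=> VWT; rewrite /gtens_comp.
elim/big_ind: _ => [|X Y XT YT|b _]; rewrite ?sub0v ?subv_add ?XT //.
by apply: tensv_subv; apply: VWT.
Qed.

Definition gtens_proj_fun a (v : V) (w : W) : tens V W :=
  \sum_(b <- hsupp V) tmul (hproj V b v) (hproj W (a - b) w).

Fact gtens_proj_fun_is_bilinear a :
  bilinear_for *:%R *:%R (gtens_proj_fun a).
Proof.
split=> [w|v] c x y; rewrite /gtens_proj_fun /= scaler_sumr -big_split;
  apply: eq_bigr => b _ /=.
  by rewrite linearP linearPl.
by rewrite linearP linearPr.
Qed.
HB.instance Definition _ a :=
  bilinear_isBilinear.Build k V W (tens V W) *:%R *:%R (gtens_proj_fun a)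
    (gtens_proj_fun_is_bilinear a).

Definition gtens_proj a : 'End(tens V W) :=
  linfun (tens_lift (gtens_proj_fun a)).

Lemma gtens_projE a a' t :
  t \in gtens_comp a -> gtens_proj a' t = if a' == a then t else 0.
Proof.
pose g : 'End(tens V W) := if a' == a then \1%VF else 0%R.
move=> ta; transitivity (g t); last by rewrite /g; case: eqP; rewrite lfunE.
apply/eqP; rewrite -subr_eq0 -opp_lfunE -add_lfunE -memv_ker.
apply: (subvP _ _ ta); apply: gtens_comp_subv => b v w Vv Ww.
rewrite memv_ker add_lfunE opp_lfunE subr_eq0; apply/eqP.
rewrite lfunE /= tens_liftE /= /gtens_proj_fun.
under eq_bigr => c _ do rewrite (hprojE _ Vv) (hprojE _ Ww).
have [bS|bS] := boolP (b \in hsupp V); last first.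
  rewrite (hcomp_notin_hsupp Vv bS) linear0l linear0 big1 // => c _.
  by rewrite if_same linear0l.
rewrite (big_rem b) //= eqxx (inj_eq (addIr _)) big_seq big1 ?addr0.
  by rewrite /g; case: eqP => _; rewrite lfunE //= linear0r.
move=> c; rewrite (mem_rem_uniq _ (hsupp_uniq V)) inE => /andP[/negPf -> _].
by rewrite linear0l.
Qed.

Fact gtens_full : exists s : seq G, (\sum_(a <- s) gtens_comp a == fullv)%VS.
Proof.
exists [seq b + c | b <- hsupp V, c <- hsupp W].
rewrite eqEsubv subvf /=; apply/subvP => t _; rewrite [t]tens_sum.
apply: memv_suml => i _; apply: memv_suml => j _; apply: memvZ.
move: (vbasis {:V})`_i (vbasis {:W})`_j => v w; rewrite -[v]hproj_sum -[w]hproj_sum.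
rewrite linear_sumlz big_seq memv_suml // => b bS.
rewrite linear_sumr big_seq memv_suml // => c cS.
rewrite (big_rem (b + c)) /=; last exact: allpairs_f.
apply: (subvP (addvSl _ _)); apply: memv_gtens (hproj_mem _ _) _.
by rewrite addrC addKr hproj_mem.
Qed.

Definition gtens : gradedVect k G :=
  GradedVect gtens_full (directv_sum_proj gtens_projE).

End GradedTensor.

Record lsColorAlgebra (k : fieldType) (G : zmodType)
    (eps : skew_bicharacter k G) := LsColorAlgebra {
  lsca_sort :> gradedVect k G;
  lsmul : {bilinear lsca_sort -> lsca_sort -> lsca_sort};
  lsmul_graded : forall a b x y,
    x \in hcomp lsca_sort a -> y \in hcomp lsca_sort b ->
    lsmul x y \in hcomp lsca_sort (a + b);
  lsmul_leftsym : forall a b c x y z,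
    x \in hcomp lsca_sort a -> y \in hcomp lsca_sort b ->
    z \in hcomp lsca_sort c ->
    lsmul (lsmul x y) z - lsmul x (lsmul y z) =
    eps a b *: (lsmul (lsmul y x) z - lsmul y (lsmul x z))
}.

Section Bimodule.
Variables (k : fieldType) (G : zmodType) (eps : skew_bicharacter k G).
Variable A : lsColorAlgebra eps.

(* The bracket of [A] on homogeneous x, y of degrees a, b. *)
Definition lie_bracket (a b : G) (x y : A) : A :=
  lsmul A x y - eps a b *: lsmul A y x.

Record is_bimodule (W : gradedVect k G)
    (l : {bilinear A -> W -> W}) (r : {bilinear W -> A -> W}) : Prop :=
  IsBimodule {
  lact_graded : forall a b x w,
    x \in hcomp A a -> w \in hcomp W b -> l x w \in hcomp W (a + b);
  ract_graded : forall a b x w,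
    x \in hcomp A a -> w \in hcomp W b -> r w x \in hcomp W (b + a);
  bimod_leftsym : forall a b c x y w,
    x \in hcomp A a -> y \in hcomp A b -> w \in hcomp W c ->
    l (lsmul A x y) w - l x (l y w) =
    eps a b *: (l (lsmul A y x) w - l y (l x w));
  bimod_mixed : forall a b c x y w,
    x \in hcomp A a -> y \in hcomp A b -> w \in hcomp W c ->
    r (l x w) y - l x (r w y) =
    eps a c *: (r (r w x) y - r w (lsmul A x y))
}.

Record bimodule := Bimodule {
  bimod_sort :> gradedVect k G;
  lact : {bilinear A -> bimod_sort -> bimod_sort};
  ract : {bilinear bimod_sort -> A -> bimod_sort};
  bimodP : is_bimodule lact ract
}.

Definition complete (V : bimodule) : Prop := forall a b c x y v,
  x \in hcomp A a -> y \in hcomp A b -> v \in hcomp V c ->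
  ract V v (lie_bracket a b x y) =
  ract V (ract V v x) y - eps a b *: ract V (ract V v y) x.

(* The prescribed actions on homogeneous elements; being bilinear, l and r are
   determined by these values. *)
Definition is_tensor_lact (V W : bimodule)
    (l : {bilinear A -> gtens V W -> gtens V W}) : Prop :=
  forall a b c x v w,
    x \in hcomp A a -> v \in hcomp V b -> w \in hcomp W c ->
    l x (tmul v w) =
    tmul (lact V x v - eps a b *: ract V v x) w
    + eps a b *: tmul v (lact W x w).

Definition is_tensor_ract (V W : bimodule)
    (r : {bilinear gtens V W -> A -> gtens V W}) : Prop :=
  forall a b c x v w,
    x \in hcomp A a -> v \in hcomp V b -> w \in hcomp W c ->
    r (tmul v w) x = tmul v (ract W w x).

End Bimodule.

(* Main.v *)
(* Put [ad x v = xv - eps(|x|,|v|) vx]. The two bimodule axioms for [V] make [ad]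
   a left module action of the associated Lie color algebra, and left symmetry
   for [W] says the same of its left action. The left action on the tensor
   product is the colored coproduct [ad (x) 1 + eps 1 (x) x] of these two
   actions, hence again a module action, which is the left-symmetry axiom. In
   the mixed axiom the [ad] terms cancel, leaving the one for [W]. *)
Require Import Defs.
From HB Require Import structures.
From mathcomp Require Import all_boot all_order all_algebra.
From mathcomp Require Import ring.

Set Implicit Arguments.
Unset Strict Implicit.
Unset Printing Implicit Defensive.

Import GRing.Theory.
Local Open Scope ring_scope.

(** Serves maps that are built inside a proof, where their bilinearity is a local fact rather than a
    declared instance. *)
Lemma bilinear_of_fun (k : fieldType) (U V W : lmodType k) (f : U -> V -> W) :
  bilinear_for *:%R *:%R f ->
  exists g : {bilinear U -> V -> W}, forall u v, g u v = f u v.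
Proof.
move=> fP; pose m := bilinear_isBilinear.Build k U V W *:%R *:%R f fP.
by pose g : {bilinear U -> V -> W} := HB.pack f m; exists g.
Qed.

Lemma tens_lift_bilin (k : fieldType) (V W : vectType k) (U : lmodType k)
    (f : V -> W -> U) :
  bilinear_for *:%R *:%R f -> forall v w, tens_lift f (tmul v w) = f v w.
Proof.
move=> fP v w; have [g gE] := bilinear_of_fun fP.
rewrite -gE -tens_liftE /tens_lift.
by apply: eq_bigr => i _; apply: eq_bigr => j _; rewrite gE.
Qed.

(** Each [tens_lift (F x)] is a fixed combination of values of [F x] at basis vectors, so linearity
    in the parameter [x] passes to the lift. Both actions are obtained this way. *)
Lemma tens_lift_param (k : fieldType) (T : lmodType k) (V W : vectType k)
    (U : lmodType k) (F : T -> V -> W -> U) :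
  (forall x, bilinear_for *:%R *:%R (F x)) ->
  (forall v w, linear (fun x => F x v w)) ->
  exists L : {bilinear T -> tens V W -> U},
    forall x v w, L x (tmul v w) = F x v w.
Proof.
move=> F2 F1; have LP : bilinear_for *:%R *:%R (fun x t => tens_lift (F x) t).
  split=> [t|x] c y z /=; last exact: linearP.
  rewrite /tens_lift scaler_sumr -big_split; apply: eq_bigr => i _.
  rewrite scaler_sumr -big_split; apply: eq_bigr => j _ /=.
  by rewrite F1 scalerDr !scalerA mulrC.
have [L LE] := bilinear_of_fun LP.
by exists L => x v w; rewrite LE tens_lift_bilin.
Qed.

Section GradedSums.
Variables (k : fieldType) (G : zmodType) (V : gradedVect k G).

(** Only the projection in degree [a] survives; if [a] lies outside [hsupp V], then [v] is 0 and
    both sides vanish. This evaluates, at a homogeneous argument, formulas extended through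
    homogeneous components. *)
Lemma sum_hproj (U : nmodType) (f : G -> V -> U) a (v : V) :
  (forall b, f b 0 = 0) -> v \in hcomp V a ->
  \sum_(b <- hsupp V) f b (hproj V b v) = f a v.
Proof.
move=> f0 Vv; have [aS|aS] := boolP (a \in hsupp V); last first.
  rewrite (hcomp_notin_hsupp Vv aS) f0 big1 // => b _.
  by rewrite linear0 f0.
rewrite (big_rem a) //= (hprojE a Vv) eqxx big_seq big1 ?addr0 // => b.
rewrite (mem_rem_uniq _ (hsupp_uniq V)) inE => /andP[/negPf ba _].
by rewrite (hprojE b Vv) ba f0.
Qed.

(** The kernel of [f - g] is a subspace, so it contains a whole component once it contains the
    homogeneous pure tensors spanning it. *)
Lemma gtens_comp_eq (W : gradedVect k G) (U : vectType k)
    (f g : {linear gtens V W -> U}) a t :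
  (forall b v w, v \in hcomp V b -> w \in hcomp W (a - b) ->
     f (tmul v w) = g (tmul v w)) ->
  t \in hcomp (gtens V W) a -> f t = g t.
Proof.
move=> fg ta; apply/eqP; rewrite -subr_eq0 -[f t]lfunE -[g t]lfunE.
rewrite -opp_lfunE -add_lfunE -memv_ker; apply: (subvP _ _ ta).
apply: gtens_comp_subv => b v w Vv Ww.
by rewrite memv_ker add_lfunE opp_lfunE subr_eq0 !lfunE /= (fg b).
Qed.

Lemma gtens_comp_stable (W : gradedVect k G) (U : vectType k)
    (f : {linear gtens V W -> U}) a (T : {vspace U}) t :
  (forall b v w, v \in hcomp V b -> w \in hcomp W (a - b) ->
     f (tmul v w) \in T) ->
  t \in hcomp (gtens V W) a -> f t \in T.
Proof.
move=> fT ta; rewrite -[f t]lfunE memv_preim; apply: (subvP _ _ ta).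
apply: gtens_comp_subv => b v w Vv Ww.
by rewrite -memv_preim lfunE /= (fT b).
Qed.

End GradedSums.

Section TensorBimodule.
Variables (k : fieldType) (G : zmodType) (eps : skew_bicharacter k G).
Variables (A : lsColorAlgebra eps) (V W : bimodule A).

(** The degrees are parameters instead of being read off from [x] and [v]: with the sign fixed, the
    formula is bilinear on all of [A] and [V]. *)
Definition ad (a b : G) (x : A) (v : V) : V :=
  lact V x v - eps a b *: ract V v x.

Fact ad_is_bilinear a b : bilinear_for *:%R *:%R (ad a b).
Proof.
split=> [v|x] c y z; rewrite /ad /= linearPl linearPr scalerDr scalerBr;
  by rewrite !scalerA [eps a b * c]mulrC opprD addrACA.
Qed.
HB.instance Definition _ a b :=
  bilinear_isBilinear.Build k A V V *:%R *:%R (ad a b) (ad_is_bilinear a b).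

Lemma ad_graded a b x v :
  x \in hcomp A a -> v \in hcomp V b -> ad a b x v \in hcomp V (a + b).
Proof.
move=> Ax Vv; rewrite memvB ?memvZ ?(lact_graded (bimodP V)) //.
by rewrite addrC (ract_graded (bimodP V)).
Qed.

Lemma bichar_inv a b : eps b a = (eps a b)^-1.
Proof.
by apply: (mulfI (bichar_neq0 eps a b)); rewrite bichar_skew divff ?bichar_neq0.
Qed.

Lemma vect_coord_eq (U : vectType k) (u v : U) :
  (forall i, coord (vbasis {:U}) i u = coord (vbasis {:U}) i v) -> u = v.
Proof.
move=> uv; rewrite (coord_vbasis (memvf u)) (coord_vbasis (memvf v)).
by apply: eq_bigr => i _; rewrite uv.
Qed.

(** Left symmetry of [V] handles (xy)v and x(yv). The mixed axiom, taken for x, y and for y, x,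
    trades (xv)y for x(vy) and (yv)x for y(vx); the terms it adds, in which only the right action
    occurs, cancel those already present. *)
Lemma ad_leftsym a b c x y v :
  x \in hcomp A a -> y \in hcomp A b -> v \in hcomp V c ->
  ad (a + b) c (lsmul A x y) v - ad a (b + c) x (ad b c y v) =
  eps a b *: (ad (b + a) c (lsmul A y x) v - ad b (a + c) y (ad a c x v)).
Proof.
move=> Ax Ay Vv.
have lE := bimod_leftsym (bimodP V) Ax Ay Vv.
have mxy := bimod_mixed (bimodP V) Ax Ay Vv.
have myx := bimod_mixed (bimodP V) Ay Ax Vv.
rewrite /ad !linearBl !linearBr !linearZl_LR !linearZr_LR /=.
(* Writing u as (u - u') + u' exposes the left side of an axiom, which can then be rewritten; the
   next two lines do the same. *)
rewrite -(subrK (lact V x (lact V y v)) (lact V (lsmul A x y) v)) lE.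
rewrite -(subrK (lact V x (ract V v y)) (ract V (lact V x v) y)) mxy.
rewrite -(subrK (lact V y (ract V v x)) (ract V (lact V y v) x)) myx.
(* Coordinates turn the vector identity into a scalar one, with [eps b a] replaced by the inverse of
   [eps a b]. *)
apply: vect_coord_eq => i; rewrite !(linearD, linearN, linearZ) /=.
rewrite !bicharDl !bicharDr (bichar_inv a b).
by field; exact: bichar_neq0.
Qed.

Lemma tensor_lact_exists :
  exists l : {bilinear A -> gtens V W -> gtens V W}, is_tensor_lact l.
Proof.
(* The signs depend on the degrees of [x] and [v] only, so these two are split into homogeneous
   components while [w] is left whole. *)
pose F (x : A) (v : V) (w : W) : tens V W :=
  \sum_(a <- hsupp A) \sum_(b <- hsupp V)
    (tmul (ad a b (hproj A a x) (hproj V b v)) w +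
     eps a b *: tmul (hproj V b v) (lact W (hproj A a x) w)).
have combE (c e : k) (X X' Y Y' : tens V W) :
    c *: X + Y + e *: (c *: X' + Y') = c *: (X + e *: X') + (Y + e *: Y').
  by rewrite scalerDr scalerA [e * c]mulrC addrACA scalerDr scalerA.
have F2 x : bilinear_for *:%R *:%R (F x).
  split=> [w|v] c y z; rewrite /F /= scaler_sumr -big_split;
    apply: eq_bigr => a _ /=; rewrite scaler_sumr -big_split;
    apply: eq_bigr => b _ /=.
    by rewrite linearP linearPr !linearPl combE.
  by rewrite !linearPr combE.
have F1 v w : linear (fun x => F x v w).
  move=> c y z; rewrite /F /= scaler_sumr -big_split;
    apply: eq_bigr => a _ /=; rewrite scaler_sumr -big_split;
    apply: eq_bigr => b _ /=.
  by rewrite linearP !linearPl linearPr combE.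
have [L LE] := tens_lift_param F2 F1.
exists L => a b c x v w Ax Vv Ww; rewrite LE /F.
(* On homogeneous arguments the outer sum collapses to the degree of [x], then the inner one to the
   degree of [v]. *)
rewrite (sum_hproj (f := fun a x => \sum_(b <- hsupp V)
  (tmul (ad a b x (hproj V b v)) w +
   eps a b *: tmul (hproj V b v) (lact W x w))) _ Ax); last first.
  move=> d; rewrite big1 // => e _.
  by rewrite !linear0l linear0r scaler0 addr0.
rewrite (sum_hproj (f := fun b v =>
  tmul (ad a b x v) w + eps a b *: tmul v (lact W x w)) _ Vv) // => d.
by rewrite linear0r !linear0l scaler0 addr0.
Qed.

Lemma tensor_ract_exists :
  exists r : {bilinear gtens V W -> A -> gtens V W}, is_tensor_ract r.
Proof.
pose F (x : A) (v : V) (w : W) : tens V W := tmul v (ract W w x).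
have F2 x : bilinear_for *:%R *:%R (F x).
  split=> [w|v] c y z; rewrite /F /=; first exact: linearPl.
  by rewrite linearPl linearPr.
have F1 v w : linear (fun x => F x v w).
  by move=> c y z; rewrite /F !linearPr.
have [L LE] := tens_lift_param F2 F1.
(* [L] takes the algebra element first; a right action takes it second. *)
have RP : bilinear_for *:%R *:%R (fun t x => L x t).
  by split=> [x|t] c y z; rewrite (linearPl, linearPr).
have [R RE] := bilinear_of_fun RP.
by exists R => a b c x v w _ _ _; rewrite RE LE.
Qed.

Lemma tensor_bimodule (l : {bilinear A -> gtens V W -> gtens V W})
    (r : {bilinear gtens V W -> A -> gtens V W}) :
  is_tensor_lact l -> is_tensor_ract r -> is_bimodule l r.
Proof.
move=> lE rE.
have adE a b x v : lact V x v - eps a b *: ract V v x = ad a b x v by [].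
split.
- move=> a b x t Ax; apply: gtens_comp_stable => d v w Vv Ww.
  rewrite /= (lE _ _ _ _ _ _ Ax Vv Ww) adE memvD ?memvZ //.
    (* The left factor has degree a + d, and (a + b) - (a + d) = b - d is the degree of [w]. *)
    apply: memv_gtens (ad_graded Ax Vv) _.
    by rewrite opprD addrACA subrr add0r.
  apply: memv_gtens Vv _; rewrite -addrA.
  exact: lact_graded (bimodP W) _ _ _ _ Ax Ww.
- move=> a b x t Ax.
  apply: (gtens_comp_stable (f := applyr r x)) => d v w Vv Ww.
  rewrite /= (rE _ _ _ _ _ _ Ax Vv Ww); apply: memv_gtens Vv _.
  rewrite addrAC; exact: ract_graded (bimodP W) _ _ _ _ Ax Ww.
- move=> a b c x y t Ax Ay.
  apply: (gtens_comp_eq (f := l (lsmul A x y) \- (l x \o l y))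
    (g := eps a b \*: (l (lsmul A y x) \- (l y \o l x)))) => d v w Vv Ww /=.
  have Axy := lsmul_graded Ax Ay; have Ayx := lsmul_graded Ay Ax.
  have lWx := lact_graded (bimodP W) Ax Ww.
  have lWy := lact_graded (bimodP W) Ay Ww.
  rewrite (lE _ _ _ _ _ _ Axy Vv Ww) (lE _ _ _ _ _ _ Ayx Vv Ww).
  rewrite (lE _ _ _ _ _ _ Ax Vv Ww) (lE _ _ _ _ _ _ Ay Vv Ww) !adE.
  (* The second action meets left factors of degree b + d or a + d. The resulting signs make the
     cross terms, with [ad] by one element on [v] and the other element acting on [w], agree on both
     sides, since [eps a b * eps b a = 1]. *)
  rewrite !linearDr !linearZr_LR /=.
  rewrite (lE _ _ _ _ _ _ Ax (ad_graded Ay Vv) Ww).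
  rewrite (lE _ _ _ _ _ _ Ay (ad_graded Ax Vv) Ww).
  rewrite (lE _ _ _ _ _ _ Ax Vv lWy) (lE _ _ _ _ _ _ Ay Vv lWx) !adE.
  rewrite -(subrK (ad a (b + d) x (ad b d y v)) (ad (a + b) d (lsmul A x y) v)).
  rewrite (ad_leftsym Ax Ay Vv).
  rewrite -(subrK (lact W x (lact W y w)) (lact W (lsmul A x y) w)).
  rewrite (bimod_leftsym (bimodP W) Ax Ay Ww).
  apply/matrixP => i j; rewrite !mxE !(linearD, linearN, linearZ) /=.
  rewrite !bicharDl !bicharDr (bichar_inv a b).
  by field; exact: bichar_neq0.
- move=> a b c x y t Ax Ay.
  apply: (gtens_comp_eq (f := (applyr r y \o l x) \- (l x \o applyr r y))
    (g := eps a c \*: ((applyr r y \o applyr r x)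
                       \- applyr r (lsmul A x y)))) => d v w Vv Ww /=.
  have Axy := lsmul_graded Ax Ay.
  have lWx := lact_graded (bimodP W) Ax Ww.
  have rWx := ract_graded (bimodP W) Ax Ww.
  have rWy := ract_graded (bimodP W) Ay Ww.
  rewrite (lE _ _ _ _ _ _ Ax Vv Ww) adE linearDl linearZl_LR /=.
  rewrite (rE _ _ _ _ _ _ Ay (ad_graded Ax Vv) Ww).
  rewrite (rE _ _ _ _ _ _ Ay Vv lWx) (rE _ _ _ _ _ _ Ay Vv Ww).
  rewrite (lE _ _ _ _ _ _ Ax Vv rWy) (rE _ _ _ _ _ _ Ax Vv Ww) adE.
  rewrite (rE _ _ _ _ _ _ Ay Vv rWx) (rE _ _ _ _ _ _ Axy Vv Ww).
  rewrite -(subrK (lact W x (ract W w y)) (ract W (lact W x w) y)).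
  rewrite (bimod_mixed (bimodP W) Ax Ay Ww).
  (* The total sign splits: [eps a d] comes from moving x past v, and [eps a (c - d)] from the mixed
     axiom of [W] at [w], which has degree c - d. *)
  have -> : eps a c = eps a d * eps a (c - d) by rewrite -bicharDr addrC subrK.
  apply/matrixP => i j; rewrite !mxE !(linearD, linearN, linearZ) /=; ring.
Qed.

End TensorBimodule.

Theorem proposition2p14 (k : fieldType) (G : zmodType)
    (eps : skew_bicharacter k G) (A : lsColorAlgebra eps)
    (V W : bimodule A) (V_complete : complete V) :
  (exists (l : {bilinear A -> gtens V W -> gtens V W})
          (r : {bilinear gtens V W -> A -> gtens V W}),
     is_tensor_lact l /\ is_tensor_ract r) /\
  (forall (l : {bilinear A -> gtens V W -> gtens V W})
          (r : {bilinear gtens V W -> A -> gtens V W}),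
     is_tensor_lact l -> is_tensor_ract r -> is_bimodule l r).
Proof.
split=> [|l r]; last exact: tensor_bimodule.
have [l lE] := tensor_lact_exists V W.
by have [r rE] := tensor_ract_exists V W; exists l, r.
Qed.
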